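(* Let $\mathcal{X}$ be a Euclidean space and $\mathcal{G}$ a compact subgroup of the orthogonal group $\mathcal{O}(\mathcal{X})$. Let $T$ be an expofam-type estimator on $\mathcal{X}$ with a generator $A$ that is closed, convex, proper and $\mathcal{G}$-invariant and penalty support set $C$. Fix $x\in\mathcal{X}$. If $Q:\mathcal{X}\to\mathcal{X}$ is a linear map, with adjoint $Q^*$, satisfying 1. (averaging) $Qu\preceq_{\mathcal{G}}u$ for all $u\in\mathcal{X}$, and 2. (dual feasibility) $Q^*(x-C)\subseteq x-C$, then $Q\,T(x)\subseteq T(x)$. Moreover, if $T$ is at most singleton-valued, then $Q\,T(x)=T(x)$.
   Context: $\mathcal{X}$ has inner product $\langle\cdot,\cdot\rangle$; $\mathcal{G}\subseteq\mathcal{O}(\mathcal{X})$ acts linearly on $\mathcal{X}$, written $g\cdot x$. A function $f$ on $\mathcal{X}$ is $\mathcal{G}$-invariant if $f(g\cdot x)=f(x)$ for all $x\in\mathcal{X}$, $g\in\mathcal{G}$. The relation $v\preceq_{\mathcal{G}}u$ means $v\in\operatorname{conv}(\mathcal{G}\cdot u)$, where $\mathcal{G}\cdot u=\{g\cdot u:g\in\mathcal{G}\}$. Expofam-type estimator: a set-valued function on $\mathcal{X}$ of the form $T(x)=\operatorname{arg\,min}_{\theta\in\mathcal{X}}A(\theta)-\langle x,\theta\rangle+h_C(\theta)$ (the set of minimizers, possibly empty or with several elements), where the generator $A:\mathcal{X}\to\mathbb{R}\cup\{+\infty\}$ is closed (lower semicontinuous), convex and proper (finite at some point), $C\subseteq\mathcal{X}$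 is a nonempty closed convex set (the penalty support set), and $h_C(\theta)=\sup_{z\in C}\langle z,\theta\rangle\in\mathbb{R}\cup\{+\infty\}$. ''At most singleton-valued'' means $T(y)$ has at most one element for every $y\in\mathcal{X}$. For a set $S\subseteq\mathcal{X}$: $QS=\{Qs:s\in S\}$ and $x-S=\{x-s:s\in S\}$. *)

(* Defs.v *)
From HB Require Import structures.
From mathcomp Require Import all_boot all_order all_algebra.
From mathcomp Require Import sesquilinear.
From mathcomp Require Import all_classical all_reals all_analysis.
Import Order.TTheory GRing.Theory Num.Theory.
Import numFieldNormedType.Exports.

Set Implicit Arguments.
Unset Strict Implicit.
Unset Printing Implicit Defensive.

Local Open Scope classical_set_scope.
Local Open Scope ring_scope.

(* A Euclidean space: a finite-dimensional real vector space with an inner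
   product, whose topology is the one of the norm |x| = sqrt <x, x>. *)
HB.mixin Record isEuclidean (R : realType) X
    of Vector R X & NormedModule R X := {
  inner : {dot X for idfun} ;
  inner_norm : forall x : X, `|x| ^+ 2 = inner x x
}.

#[short(type="euclideanType")]
HB.structure Definition Euclidean (R : realType) :=
  {X of isEuclidean R X & Vector R X & NormedModule R X}.

Section Defs.
Context {R : realType} {X : euclideanType R}.
Implicit Types (G : set 'End(X)) (A : X -> \bar R) (C : set X).

Local Notation "<< u , v >>" := (inner u v).

Definition is_adjoint (Q Qstar : 'End(X)) :=
  forall u v : X, << Q u, v >> = << u, Qstar v >>.

Definition orthogonal_group : set 'End(X) :=
  [set g | forall u v : X, << g u, g v >> = << u, v >>].

(* As X is finite-dimensional, the usual topology of 'End(X) is that of pointwise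
   convergence.  The inverse of lfun is the two-sided one on isometries. *)
Record compact_orthogonal_subgroup G : Prop := {
  sub_orthogonal : G `<=` orthogonal_group ;
  subgroup_id : G \1%VF ;
  subgroup_comp : forall g h, G g -> G h -> G (g \o h)%VF ;
  subgroup_inv : forall g, G g -> G (g^-1)%VF ;
  subgroup_compact : compact
    ([set fun_of_lfun g | g in G] : set {ptws X -> X})
}.

Definition group_invariant {Y : Type} G (f : X -> Y) :=
  forall (g : 'End(X)) (x : X), G g -> f (g x) = f x.

Definition orbit G (u : X) : set X := [set g u | g in G].

Definition convex_hull (S : set X) : set X := smallest (@convex_set R X) S.

Definition group_majorized G (v u : X) := convex_hull (orbit G u) v.

Local Open Scope ereal_scope.

Definition econvex_function A := forall (x y : X) (t : R), (0 <= t <= 1)%R ->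
  A (t *: x + (1 - t) *: y)%R <= t%:E * A x + (1 - t)%:E * A y.

Record closed_convex_proper A : Prop := {
  ccp_gtNy : forall x, -oo < A x ;
  ccp_closed : lower_semicontinuous A ;
  ccp_convex : econvex_function A ;
  ccp_proper : exists x, A x \is a fin_num
}.

Definition support_function C (theta : X) : \bar R :=
  ereal_sup [set << z, theta >>%:E | z in C].

Definition argmin (F : X -> \bar R) : set X :=
  [set theta | forall eta, F theta <= F eta].

Definition expofam_estimator A C (x : X) : set X :=
  argmin (fun theta => A theta - << x, theta >>%:E + support_function C theta).

End Defs.

(* Main.v *)
Require Import Defs.
From mathcomp Require Import all_boot all_order all_algebra.
From mathcomp Require Import sesquilinear.
From mathcomp Require Import lra.
From mathcomp Require Import all_classical all_reals all_analysis.
Import Order.TTheory GRing.Theory Num.Theory.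
Import numFieldNormedType.Exports.

Local Open Scope classical_set_scope.
Local Open Scope ring_scope.

(** Fix a minimizer [t] of the objective
    [F theta = A theta - <x, theta> + h_C theta].  The two conditions on [Q]
    control the two parts of [F] separately, and together give
    [F (Q t) <= F t], so that [Q t] is again a minimizer.

    - The generator: every sublevel set of [A] is convex and stable under [G],
      hence contains the convex hull of the orbit of each of its points.
      Averaging puts [Q t] in the hull of the orbit of [t], so
      [A (Q t) <= A t] ([majorized_invariant_le]).
    - The penalty: [h_C theta - <x, theta>] is the supremum of
      [- <w, theta>] for [w] in [x - C].  Evaluating at [Q t] moves [Q] onto [w]
      as its adjoint, and dual feasibility keeps the result in [x - C]:
      the supremum is taken over fewer values ([dual_feasible_penalty_le]).

    When [T x] has at most one element [t], the inclusion forces [Q t = t],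
    which is the reverse inclusion. *)

Section Majorization.
Context {R : realType} {X : euclideanType R}.
Local Open Scope ereal_scope.

Lemma convex_sublevel (A : X -> \bar R) (c : \bar R) :
  econvex_function A -> convex_set [set v : X | A v <= c].
Proof.
move=> cvxA u v l; rewrite !inE /= => Au Av.
have l_le1 : (0 <= 1 - l%:num)%R by rewrite subr_ge0.
apply: (le_trans (cvxA u v l%:num _)); first by apply/andP; split.
(* Nonnegative coefficients distribute over infinite levels as well. *)
have -> : c = l%:num%:E * c + (1 - l%:num)%:E * c.
  by rewrite -ge0_muleDl ?lee_fin // -EFinD addrC subrK mul1e.
by apply: leeD; apply: lee_wpmul2l => //; rewrite lee_fin.
Qed.

(** Convex invariant functions are monotone for the majorization order: the
    sublevel set of [A] at height [A u] is a convex set containing the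
    orbit of [u]. *)
Lemma majorized_invariant_le (G : set 'End(X)) (A : X -> \bar R) (u v : X) :
  econvex_function A -> group_invariant G A ->
  group_majorized G v u -> A v <= A u.
Proof.
move=> cvxA invA vu.
apply: (smallest_sub (convex_sublevel _ (A u) cvxA) _ vu).
by move=> _ [g Gg <-] /=; rewrite invA.
Qed.

End Majorization.

Section Penalty.
Context {R : realType} {X : euclideanType R}.

Lemma innerC (u v : X) : inner u v = inner v u.
Proof. by rewrite hermC expr0 mul1r. Qed.

Local Open Scope ereal_scope.

Lemma dual_feasible_penalty_le (C : set X) (x : X) (Q Qstar : 'End(X)) (t : X) :
  is_adjoint Q Qstar ->
  [set Qstar y | y in [set x - z | z in C]]%R `<=` [set x - z | z in C]%R ->
  support_function C (Q t) - (inner x (Q t))%:E <=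
  support_function C t - (inner x t)%:E.
Proof.
move=> adjQ feas; rewrite leeBlDr //; apply: ge_ereal_sup => _ [z Cz <-].
(* The feasible point that stands for [z] at [t]: [Qstar (x - z) = x - z']. *)
have [z' Cz' z'E] : [set x - z | z in C]%R (Qstar (x - z)%R).
  by apply: feas; exists (x - z)%R => //; exists z.
have dualE : (inner z (Q t) = inner z' t - inner x t + inner x (Q t))%R.
  have : inner (x - z)%R (Q t) = inner (x - z')%R t.
    by rewrite innerC adjQ -z'E innerC.
  by rewrite !linearBl; lra.
rewrite dualE EFinD EFinB; apply/leeD => //; apply/leeD => //.
by apply: ereal_sup_ubound; exists z'.
Qed.

End Penalty.

Theorem theorem1 (R : realType) (X : euclideanType R)
    (G : set 'End(X)) (A : X -> \bar R) (C : set X) (x : X)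
    (Q Qstar : 'End(X))
    (T := expofam_estimator A C)
    (hG : compact_orthogonal_subgroup G)
    (hA : closed_convex_proper A)
    (hAG : group_invariant G A)
    (C_nonempty : C !=set0)
    (C_closed : closed C)
    (C_convex : convex_set C)
    (hQ : is_adjoint Q Qstar)
    (averaging : forall u : X, group_majorized G (Q u) u)
    (dual_feasible :
      [set Qstar y | y in [set x - z | z in C]] `<=` [set x - z | z in C]) :
  [set Q t | t in T x] `<=` T x /\
  ((forall y : X, is_subset1 (T y)) -> [set Q t | t in T x] = T x).
Proof.
have T_stable t : T x t -> T x (Q t).
  move=> Tt eta; apply: le_trans (Tt eta).
  have [_ _ cvxA _] := hA.
  rewrite -!addeA; apply: leeD; first exact: (majorized_invariant_le G).
  by rewrite addeC [leRHS]addeC; exact: (dual_feasible_penalty_le C x Q Qstar).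
split; first by move=> _ [t Tt <-]; exact: T_stable.
move=> T_sub1; apply/seteqP; split; first by move=> _ [t Tt <-]; exact: T_stable.
by move=> t Tt; exists t => //; apply: (T_sub1 x) => //; exact: T_stable.
Qed.
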